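(* Let $N,K\geq 1$ be natural numbers. (1) The Boltzmann-on-numbers distribution is stable under reversal: as functions $\{0,1,\ldots,(N-1)\cdot K\}\to\mathcal{D}(\boldsymbol{N})$, $$\mathcal{D}(\mathrm{rev}_{N-1})\circ\mathrm{BoN}[N,K] \;=\; \mathrm{BoN}[N,K]\circ\mathrm{rev}_{(N-1)\cdot K}.$$ (2) For each $0\leq i\leq (N-1)\cdot K$, the mean of the Boltzmann-on-numbers distribution is $\frac{i}{K}$, independently of $N$: $$\mathrm{Mean}\big(\mathrm{BoN}[N,K](i)\big) \;=\; \frac{i}{K}.$$
   Context: For $N\geq 1$ write $\boldsymbol{N}=\{0,1,\ldots,N-1\}\subseteq\mathbb{N}$. For $K\in\mathbb{N}$ and $0\leq i\leq (N-1)\cdot K$, the $N$-nomial coefficient is $$C_{N}(K,i) := \big|\{(n_1,\ldots,n_K)\in\boldsymbol{N}^{K} \mid n_1+\cdots+n_K = i\}\big|.$$ For $L\in\mathbb{N}$, $\mathrm{rev}_{L}\colon\{0,\ldots,L\}\to\{0,\ldots,L\}$ is the bijection $\mathrm{rev}_{L}(i)=L-i$. A multiset over a set $X$ is a function $\varphi\colon X\to\mathbb{N}$ with finite support. Its size is $\|\varphi\| := \sum_{x}\varphi(x)$, and its multiset coefficient is $(\varphi) := \|\varphi\|!/\prod_{x}\varphi(x)!$. For $0\leq i\leq (N-1)\cdot K$, $\mathcal{M}[K,i](\boldsymbol{N})$ is the set of multisets $\varphi$ over $\boldsymbol{N}$ with $\|\varphi\|=K$ and $\sum_{0\leq j<N}\varphi(j)\cdot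 j=i$. $\mathcal{D}(X)$ is the set of finitely supported probability distributions on $X$; a formal sum $\sum_k r_k|x_k\rangle$ denotes the distribution giving weight $r_k$ to $x_k$ (weights of equal elements are added). For $f\colon X\to Y$ the image distribution is $\mathcal{D}(f)\big(\sum_k r_k|x_k\rangle\big) := \sum_k r_k|f(x_k)\rangle\in\mathcal{D}(Y)$. For $\omega\in\mathcal{D}(\boldsymbol{N})$, $\mathrm{Mean}(\omega) := \sum_{j}\omega(j)\cdot j$. For $N,K\geq 1$ and $0\leq i\leq (N-1)\cdot K$, the Boltzmann-on-numbers distribution $\mathrm{BoN}[N,K](i)\in\mathcal{D}(\boldsymbol{N})$ is $$\mathrm{BoN}[N,K](i) := \sum_{0\leq j<N}\ \sum_{\varphi\in\mathcal{M}[K,i](\boldsymbol{N})} \frac{(\varphi)\cdot\varphi(j)}{C_{N}(K,i)\cdot K}\,|j\rangle .$$ *)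

(* Defs.v *)
From HB Require Import structures.
From mathcomp Require Import all_boot all_order all_algebra.
From mathcomp Require Import finmap multiset.

Set Implicit Arguments.
Unset Strict Implicit.
Unset Printing Implicit Defensive.

Import Order.TTheory GRing.Theory Num.Theory.

Local Open Scope mset_scope.
Local Open Scope fset_scope.
Local Open Scope ring_scope.

(* The set {0, .., L} is 'I_L.+1, and 'I_N is {0, .., N-1} for N > 0.  The
   reversal i |-> L - i is the library's [rev_ord], which maps i : 'I_n to
   n - i.+1, that is, to L - i when n = L.+1. *)

Definition nomial (N K i : nat) : nat :=
  #|[set t : K.-tuple 'I_N | (\sum_(k < K) tnth t k)%N == i]|.

Section Multisets.
Variable X : choiceType.

Definition msize (phi : {mset X}) : nat :=
  (\sum_(x <- finsupp phi) phi x)%N.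

Definition mcoef (R : realFieldType) (phi : {mset X}) : R :=
  ((msize phi)`!)%:R / (\prod_(x <- finsupp phi) (phi x)`!)%N%:R.

End Multisets.

(* The multisets of size K over the finite type 'I_N form a finite set because
   each of them is the multiset of entries of some K-tuple; [in_multisets]
   below states that drawing from these loses nothing. *)
Definition multisets (N K i : nat) : {fset {mset 'I_N}} :=
  [fset phi in [fset seq_mset (val t) | t in {: K.-tuple 'I_N}]
     | (msize phi == K) && ((\sum_(j < N) phi j * j)%N == i)].

Section Distributions.
Variables (R : realFieldType) (X : choiceType).

Definition is_dist (w : {fsfun X -> R with 0}) : bool :=
  all (fun x => 0 <= w x) (finsupp w) && (\sum_(x <- finsupp w) w x == 1).

Record dist := Dist { dist_fun :> {fsfun X -> R with 0}; _ : is_dist dist_fun }.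

HB.instance Definition _ := [isSub for dist_fun].

End Distributions.

Definition mean (R : realFieldType) (N : nat) (w : dist R 'I_N) : R :=
  \sum_(j < N) w j * j%:R.

Section Image.
Variables (R : realFieldType) (X Y : choiceType) (f : X -> Y) (w : dist R X).

Definition dmap_fun : {fsfun Y -> R with 0} :=
  [fsfun y in [fset f x | x in finsupp w]
     => \sum_(x <- finsupp w | f x == y) w x].

Lemma dmap_subproof : is_dist dmap_fun.
Proof.
rewrite /dmap_fun; case: w => w' /= /andP[/allP w0 /eqP w1].
set g := (X in is_dist X).
have sub : finsupp g `<=` [fset f x | x in finsupp w'].
  by apply: finsupp_sub.
apply/andP; split.
  apply/allP => y _; rewrite fsfunE; case: ifP => // _.
  by rewrite big_seq_cond; apply: sumr_ge0 => x /andP[/w0].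
rewrite (big_fset_incl _ sub) => [|y _]; last first.
  by rewrite memNfinsupp => /eqP.
apply/eqP; rewrite -w1 (partition_big_imfset _ f) /=.
by rewrite !big_seq; apply: eq_bigr => y yI; rewrite fsfunE yI.
Qed.

Definition dmap : dist R Y := Dist dmap_subproof.

End Image.

Section FinsuppBig.
Variables (N : nat) (V : eqType) (v0 : V) (w : {fsfun 'I_N -> V with v0}).

Lemma big_finsupp (A : Type) (idx : A) (op : Monoid.com_law idx)
    (F : 'I_N -> A) :
  (forall j, w j = v0 -> F j = idx) ->
  \big[op/idx]_(j <- finsupp w) F j = \big[op/idx]_(j < N) F j.
Proof.
move=> F0; rewrite big_uniq ?fset_uniq //= big_mkcond /=.
by apply: eq_bigr => j _; case: ifPn => //; rewrite memNfinsupp => /eqP/F0.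
Qed.

End FinsuppBig.

Lemma msizeE (N : nat) (phi : {mset 'I_N}) :
  msize phi = (\sum_(j < N) phi j)%N.
Proof. exact: (@big_finsupp _ _ _ phi). Qed.

Lemma mfactE (N : nat) (phi : {mset 'I_N}) :
  (\prod_(x <- finsupp phi) (phi x)`!)%N = (\prod_(j < N) (phi j)`!)%N.
Proof. by apply: (@big_finsupp _ _ _ phi) => j ->. Qed.

Lemma size_mset (N : nat) (phi : {mset 'I_N}) : size phi = msize phi.
Proof.
rewrite msizeE -sum1_size sum_mset /=.
rewrite (@big_finsupp _ _ _ phi) /=; last by move=> j ->.
by apply: eq_bigr => j _; rewrite muln1.
Qed.

Lemma in_multisets (N K i : nat) (phi : {mset 'I_N}) :
  (phi \in multisets N K i) =
  (msize phi == K) && ((\sum_(j < N) phi j * j)%N == i).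
Proof.
rewrite !inE /=; case: eqP => [sz|]; last by rewrite andbF.
rewrite andTb; case: eqP => _; rewrite ?andbF ?andbT //.
apply/imfsetP; rewrite -size_mset in sz.
have szb : size phi == K by apply/eqP.
by exists (Tuple szb); rewrite //= seq_mset_id.
Qed.

Lemma card_cons (T : finType) (K : nat) (A : {set K.+1.-tuple T}) :
  #|A| = (\sum_x #|[set t : K.-tuple T | [tuple of x :: t] \in A]|)%N.
Proof.
rewrite -sum1_card.
rewrite (reindex (fun p : T * K.-tuple T => [tuple of p.1 :: p.2]))
  /=; last first.
  exists (fun t : K.+1.-tuple T => (thead t, [tuple of behead t]))
    => [[x t] _|t _] /=.
    by congr pair; apply: val_inj.
  by rewrite -tuple_eta.
rewrite -(pair_big_dep xpredT
  (fun x (t : K.-tuple T) => [tuple of x :: t] \in A) (fun _ _ => 1%N)) /=.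
by apply: eq_bigr => x _; rewrite sum1_card;
  apply: eq_card => t; rewrite !inE.
Qed.

Lemma card_mult_tuple (T : finType) (K : nat) (c : T -> nat) :
  (\sum_x c x)%N = K ->
  (#|[set t : K.-tuple T | [forall x, count_mem x t == c x]]|
     * \prod_x (c x)`! = K`!)%N.
Proof.
elim: K c => [|K IH] c cK.
  have c0 x : c x = 0%N.
    by apply/eqP; rewrite -leqn0 -cK (bigD1 x) //= leq_addr.
  rewrite big1 ?muln1 => [|x _]; last by rewrite c0.
  rewrite (_ : [set _ | _] = [set [tuple]]) ?cards1 //.
  apply/setP=> t; rewrite !inE tuple0 eqxx; apply/forallP => x.
  by rewrite c0.
pose c' x y := (c y - (y == x))%N.
have step x : (c x * (#|[set t : K.-tuple T |
      [forall y, count_mem y t == c' x y]]| * \prod_y (c' x y)`!)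
      = c x * K`!)%N.
  case: (posnP (c x)) => [->|cx]; first by rewrite !mul0n.
  congr (_ * _)%N; apply: IH; rewrite /c'.
  have := cK; rewrite (bigD1 x) //= (bigD1 x (P := predT)) //= eqxx.
  rewrite [X in (_ - _ + X)%N = _](eq_bigr c) => [|y /negPf ->]; last first.
    by rewrite subn0.
  by case: (c x) cx => // n _; rewrite subn1 /= addSn => -[].
rewrite factS -[in RHS]cK big_distrl /= -(eq_bigr _ (fun x _ => step x)).
rewrite card_cons big_distrl /=; apply: eq_bigr => x _.
case: (posnP (c x)) => [cx|cx].
  rewrite cx mul0n [#|_|]eq_card0 // => t; rewrite !inE.
  by apply/forallP => /(_ x) /=; rewrite eqxx cx.
have -> : (\prod_y (c y)`! = c x * \prod_y (c' x y)`!)%N.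
  rewrite (bigD1 x) //= [in RHS](bigD1 x) //= mulnA /c' eqxx; congr (_ * _)%N.
    by case: (c x) cx => // n _; rewrite factS subn1.
  by apply: eq_bigr => y /negPf ->; rewrite subn0.
rewrite mulnCA; congr (_ * (_ * _))%N; apply: eq_card => t; rewrite !inE.
apply: eq_forallb => y /=; rewrite /c' eq_sym.
have [->|_] := eqVneq y x; last by rewrite add0n subn0.
by case: (c x) cx => // n _; rewrite add1n subn1 eqSS.
Qed.

Lemma sum_tuple_mset (N K : nat) (t : K.-tuple 'I_N) :
  (\sum_(j < N) seq_mset (val t) j * j = \sum_(k < K) tnth t k)%N.
Proof.
rewrite -(big_tuple _ _ t predT (fun j => nat_of_ord j)) /=.
rewrite -(perm_big _ (perm_eq_seq_mset t)) /= sum_mset /=.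
by rewrite (@big_finsupp _ _ _ (seq_mset t)) //= => j ->.
Qed.

Section Coefficients.
Variable R : realFieldType.

Lemma mcoef_ge0 (X : choiceType) (phi : {mset X}) : 0 <= mcoef R phi.
Proof. by rewrite divr_ge0 ?ler0n. Qed.

Lemma mcoef_card (N K : nat) (phi : {mset 'I_N}) : msize phi = K ->
  mcoef R phi = #|[set t : K.-tuple 'I_N | seq_mset (val t) == phi]|%:R.
Proof.
move=> sz; rewrite /mcoef sz mfactE.
have sz' : (\sum_j phi j)%N = K by rewrite -msizeE.
rewrite -(card_mult_tuple sz') natrM mulfK; last first.
  by rewrite pnatr_eq0 -lt0n prodn_gt0 // => j; rewrite fact_gt0.
congr (_%:R); apply: eq_card => t; rewrite !inE.
apply/forallP/mset_eqP => [ct j|ct j]; first by rewrite mset_seqE (eqP (ct j)).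
by rewrite -ct mset_seqE.
Qed.

Lemma sum_mcoef (N K i : nat) :
  \sum_(phi <- multisets N K i) mcoef R phi = (nomial N K i)%:R.
Proof.
rewrite /nomial -sum1_card natr_sum.
transitivity (\sum_(phi <- multisets N K i)
    \sum_(t : K.-tuple 'I_N | seq_mset (val t) == phi) (1%:R : R)).
  rewrite !big_seq; apply: eq_bigr => phi; rewrite in_multisets.
  case/andP=> /eqP sz _; rewrite (mcoef_card sz) -sum1_card natr_sum.
  by apply: eq_bigl => t; rewrite inE.
rewrite (exchange_big_dep predT) //= [RHS]big_mkcond /=.
apply: eq_bigr => t _; rewrite inE -sum_tuple_mset.
under eq_bigl do rewrite eq_sym.
case: ifPn => [ti|nti].
  rewrite -big_filter filter_pred1_uniq ?fset_uniq ?big_seq1 //.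
  rewrite in_multisets ti andbT -size_mset (perm_size (perm_eq_seq_mset _)).
  by rewrite size_tuple.
rewrite big_seq_cond big_pred0 // => phi; rewrite in_multisets.
by apply/negP => /andP[/andP[_ ti] /eqP E]; rewrite -E ti in nti.
Qed.

End Coefficients.

Lemma nomial_gt0 (N K i : nat) : (0 < N)%N -> (i <= N.-1 * K)%N ->
  (0 < nomial N K i)%N.
Proof.
case: N => // N _ /= iNK; suff [t ti] : exists t : K.-tuple 'I_N.+1,
    (\sum_(j <- t) j)%N = i.
  apply/card_gt0P; exists t; rewrite inE.
  by rewrite -(big_tuple _ _ t predT (fun j => nat_of_ord j)) ti.
elim: K i iNK => [|K IH] i; first by rewrite muln0 leqn0 => /eqP ->;
  exists [tuple]; rewrite big_nil.
rewrite mulnS => iNK.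
have [t ti] : exists t : K.-tuple 'I_N.+1, (\sum_(j <- t) j)%N = (i - minn i N)%N.
  by apply: IH; rewrite leq_subLR; case: (leqP i N) => // _; rewrite leq_addr.
exists [tuple of inord (minn i N) :: t]; rewrite big_cons ti.
by rewrite inordK ?ltnS ?geq_minr // subnKC ?geq_minl.
Qed.

Section Boltzmann.
Variables (R : realFieldType) (N K : nat) (N_gt0 : (0 < N)%N) (K_gt0 : (0 < K)%N).
Variable i : 'I_((N - 1) * K).+1.

(* In the formal sum over j the kets |j> are pairwise distinct, so the weight of
   j is the inner sum over the multisets. *)
Definition BoN_fun : {fsfun 'I_N -> R with 0} :=
  [fsfun j in [fset j | j in 'I_N] =>
    \sum_(phi <- multisets N K i)
      (mcoef R phi * (phi j)%:R) / ((nomial N K i)%:R * K%:R)].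

Lemma BoN_funE (j : 'I_N) :
  BoN_fun j = \sum_(phi <- multisets N K i)
      (mcoef R phi * (phi j)%:R) / ((nomial N K i)%:R * K%:R).
Proof. by rewrite fsfunE !inE. Qed.

Lemma BoN_subproof : is_dist BoN_fun.
Proof.
apply/andP; split.
  apply/allP => j _; rewrite BoN_funE; apply: sumr_ge0 => phi _.
  by apply: divr_ge0; apply: mulr_ge0; rewrite ?ler0n ?mcoef_ge0.
rewrite (@big_finsupp _ _ _ BoN_fun) //=.
rewrite (eq_bigr _ (fun j _ => BoN_funE j)) exchange_big /=.
have C0 : (nomial N K i)%:R != 0 :> R.
  by rewrite pnatr_eq0 -lt0n nomial_gt0 // -subn1 -ltnS.
have K0 : K%:R != 0 :> R by rewrite pnatr_eq0 -lt0n.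
rewrite big_seq (eq_bigr (fun phi => mcoef R phi / (nomial N K i)%:R)).
  by rewrite -big_seq -mulr_suml sum_mcoef divff.
move=> phi; rewrite in_multisets => /andP[/eqP sz _].
by rewrite -mulr_suml -mulr_sumr -natr_sum -msizeE sz -mulf_div divff ?mulr1.
Qed.

Definition BoN : dist R 'I_N := Dist BoN_subproof.

End Boltzmann.

(* Main.v *)
Require Import Defs.
From mathcomp Require Import all_boot all_order all_algebra.
From mathcomp Require Import finmap multiset.

Import Order.TTheory GRing.Theory Num.Theory.
Local Open Scope ring_scope.

(** (1) Pushing a multiset forward along j |-> N-1-j preserves its size and its
multiset coefficient and turns the weighted sum i into (N-1)K - i, so it is a
bijection between the index sets of the two Boltzmann distributions.
(2) After exchanging the two sums, each multiset contributes its coefficient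
times i, and the coefficients add up to C_N(K,i). *)

Lemma nomial_neq0 (R : realFieldType) (N K : nat) (i : 'I_((N - 1) * K).+1) :
  (0 < N)%N -> (nomial N K i)%:R != 0 :> R.
Proof.
by move=> N0; rewrite pnatr_eq0 -lt0n nomial_gt0 // -subn1 -ltnS.
Qed.

Lemma mean_BoN (R : realFieldType) (N K : nat)
    (N_gt0 : (0 < N)%N) (K_gt0 : (0 < K)%N) (i : 'I_((N - 1) * K).+1) :
  mean (BoN R N_gt0 K_gt0 i) = i%:R / K%:R.
Proof.
have C0 := nomial_neq0 R N K i N_gt0.
rewrite /mean /=; under eq_bigr do rewrite BoN_funE mulr_suml.
rewrite exchange_big /= big_seq.
rewrite (eq_bigr (fun phi => mcoef R phi * (i%:R / ((nomial N K i)%:R * K%:R)))).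
  by rewrite -big_seq -mulr_suml sum_mcoef invfM mulrCA mulVKf.
(* Membership, kept by [big_seq], lets [i] be replaced by the weighted sum of [phi]. *)
move=> phi; rewrite in_multisets => /andP[_ /eqP <-].
rewrite natr_sum mulr_suml mulr_sumr; apply: eq_bigr => j _.
by rewrite natrM mulrAC -!mulrA.
Qed.

(** By injectivity, [x] is the only possible preimage of [f x], so at most one term survives in the
    image weight. *)
Lemma dmap_injE {R : realFieldType} {X Y : choiceType} (f : X -> Y)
    (w : dist R X) (x : X) :
  injective f -> dmap f w (f x) = w x.
Proof.
move=> f_inj; rewrite fsfunE; case: ifPn => [_|fxN].
  under eq_bigl do rewrite (inj_eq f_inj).
  case: (boolP (x \in finsupp w)) => [xw|xw].
    by rewrite -big_filter filter_pred1_uniq ?fset_uniq ?big_seq1.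
  rewrite big_seq_cond big_pred0 ?fsfun_dflt // => y.
  by apply/negP => /andP[yw /eqP E]; rewrite -E yw in xw.
(* If [f x] is not in the image of the support, then [x] is not in the support, and both weights are
   the default 0. *)
by rewrite fsfun_dflt //; apply: contra fxN => xw; apply/imfsetP; exists x.
Qed.

Definition mset_rev {N : nat} (phi : {mset 'I_N}%mset) : {mset 'I_N}%mset :=
  seq_mset (map (@rev_ord N) phi).

Lemma mset_revE {N : nat} (phi : {mset 'I_N}%mset) (j : 'I_N) :
  mset_rev phi j = phi (rev_ord j).
Proof.
rewrite mset_seqE count_map -count_mem_mset; apply: eq_count => x /=.
by rewrite (canF_eq (@rev_ordK N)).
Qed.

Lemma mset_revK {N : nat} : involutive (@mset_rev N).
Proof. by move=> phi; apply/msetP => j; rewrite !mset_revE rev_ordK. Qed.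

Lemma msize_rev {N : nat} (phi : {mset 'I_N}%mset) :
  msize (mset_rev phi) = msize phi.
Proof.
rewrite !msizeE [RHS](reindex_inj rev_ord_inj) /=.
by apply: eq_bigr => j _; rewrite mset_revE.
Qed.

Lemma mcoef_rev (R : realFieldType) {N : nat} (phi : {mset 'I_N}%mset) :
  mcoef R (mset_rev phi) = mcoef R phi.
Proof.
rewrite /mcoef msize_rev !mfactE; congr (_ / _%:R).
rewrite [RHS](reindex_inj rev_ord_inj) /=.
by apply: eq_bigr => j _; rewrite mset_revE.
Qed.

(** Each occurrence of [j] contributes [N - 1 - j] to one sum and [j] to the other. The additive
    form avoids truncated subtraction. *)
Lemma sum_mset_rev {N : nat} (phi : {mset 'I_N}%mset) :
  (\sum_(j < N) mset_rev phi j * j + \sum_(j < N) phi j * j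
   = (N - 1) * msize phi)%N.
Proof.
rewrite (reindex_inj rev_ord_inj) /= -big_split /= msizeE big_distrr /=.
apply: eq_bigr => j _; rewrite mset_revE rev_ordK -mulnDr mulnC /=.
case: N j {phi} (phi j) => [[]|n] // j m.
by rewrite subSS subn1 subnK // -ltnS.
Qed.

Lemma mset_rev_multisets (N K i : nat) (phi : {mset 'I_N}%mset) :
  (i <= (N - 1) * K)%N ->
  (mset_rev phi \in multisets N K ((N - 1) * K - i))
  = (phi \in multisets N K i).
Proof.
move=> iL; rewrite !in_multisets msize_rev; case: eqP => //= sz.
have := sum_mset_rev phi; rewrite sz => sumE.
(* Adding the weighted sum of [phi] to both sides makes the left one [(N - 1) * K]; then
   [(N - 1) * K - i] cancels, as [iL] allows. *)
rewrite -(eqn_add2r (\sum_(j < N) phi j * j)) sumE -{1}(subnK iL) eqn_add2l.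
by rewrite eq_sym.
Qed.

Lemma sum_multisets_rev (R : realFieldType) (N K i : nat)
    (F : {mset 'I_N}%mset -> R) : (i <= (N - 1) * K)%N ->
  \sum_(phi <- multisets N K ((N - 1) * K - i)) F phi
  = \sum_(phi <- multisets N K i) F (mset_rev phi).
Proof.
move=> iL; rewrite -[RHS](big_map (mset_rev) xpredT F).
(* Both enumerations are duplicate-free, so it suffices to compare their members. *)
apply: perm_big; apply: uniq_perm; rewrite ?fset_uniq //.
  by rewrite (map_inj_uniq (inv_inj mset_revK)) fset_uniq.
move=> phi; rewrite -[phi]mset_revK (mem_map (inv_inj mset_revK)).
exact: mset_rev_multisets.
Qed.

(** Both sides are sums of multiset coefficients, which reversal preserves; these live in [R], hence
    the cast. *)
Lemma nomial_rev (R : realFieldType) (N K i : nat) : (i <= (N - 1) * K)%N ->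
  (nomial N K ((N - 1) * K - i))%:R = (nomial N K i)%:R :> R.
Proof.
move=> iL; rewrite -!sum_mcoef sum_multisets_rev //.
by apply: eq_bigr => phi _; rewrite mcoef_rev.
Qed.

Theorem lemma6 (R : realFieldType) (N K : nat)
    (N_gt0 : (0 < N)%N) (K_gt0 : (0 < K)%N) :
  (dmap (@rev_ord N) \o BoN R N_gt0 K_gt0
     =1 BoN R N_gt0 K_gt0 \o @rev_ord ((N - 1) * K).+1) /\
  (forall i : 'I_((N - 1) * K).+1,
     mean (BoN R N_gt0 K_gt0 i) = i%:R / K%:R).
Proof.
split=> [i|i]; last exact: mean_BoN.
have iL : (i <= (N - 1) * K)%N by rewrite -ltnS.
apply: val_inj; apply/fsfunP => j /=.
(* Writing [j] as the reversal of [rev_ord j] exhibits its unique preimage. *)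
rewrite -[j in LHS]rev_ordK [LHS]dmap_injE; last exact: rev_ord_inj.
rewrite [LHS]BoN_funE BoN_funE /= subSS nomial_rev // sum_multisets_rev //.
by apply: eq_bigr => phi _; rewrite mcoef_rev mset_revE.
Qed.
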